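(* Let $\Gamma$ be a ribbon graph, $n$ a positive integer, $\Gamma^\flat_E$ the blowup of $\Gamma$ with its canonical perfect matching, $\langle\Gamma^\flat_E\rangle_n$ its $n$-bracket, and $P(\Gamma,k)$ the Penrose polynomial of $\Gamma$. For $n$ even, write $\langle\Gamma^\flat_E\rangle_n=\langle\Gamma^\flat_E\rangle_n(q,b)$; then $$\langle\Gamma^\flat_E\rangle_n(q,b)=\begin{cases}P(\Gamma,3n)&\text{when }q=b=1,\\ P(\Gamma,n)&\text{when }q=1,\ b=-1.\end{cases}$$ For $n$ odd, write $\langle\Gamma^\flat_E\rangle_n=\langle\Gamma^\flat_E\rangle_n(q)$; then $\langle\Gamma^\flat_E\rangle_n(1)=P(\Gamma,3n)$.
   Context: **Ribbon graphs.** Graphs are finite undirected multigraphs, connected with nonempty edge set. An (oriented) ribbon graph is a graph $G$ embedded in an oriented compact surface with boundary that deformation retracts onto $G$; equivalently, $G$ with a cyclic order of the half-edges at each vertex. It is represented by a ribbon diagram: a drawing of $G$ in the plane with vertices as dots and edges as curves that may cross, inducing the given cyclic orders counterclockwise. A perfect matching graph $\Gamma_M$ is a ribbon graph with a perfect matching $M$ of its underlying graph (each vertex is incident to exactly one edge of $M$). **Blowup.** The blowup $\Gamma^\flat$ of $\Gamma$ is the trivalent ribbon graph obtained by replacing every vertex of degree $d$ by a small circle carrying $d$ vertices, one at the end of each of the $d$ incident half-edges, in their cyclic order. The edges of the underlying graph of $\Gamma$ form the canonical perfect matching $E$ of $\Gamma^\flat$; this gives the perfect matching graph $\Gamma^\flat_E$.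 **Brackets.** Draw a matching edge $e$ of a trivalent perfect matching graph vertically, with the two other half-edges at its top vertex going up-left and up-right, and the two other half-edges at its bottom vertex going down-left and down-right. The 0-smoothing deletes $e$ and its endpoints and joins up-left with down-left and up-right with down-right; the 1-smoothing joins up-left with down-right and up-right with down-left. The bracket with parameters $A,B,C$ is determined by $\langle\Gamma_M\rangle=A\langle\text{0-smoothing at }e\rangle+B\langle\text{1-smoothing at }e\rangle$ for every matching edge $e$, $\langle\text{circle}\rangle=C$, and $\langle\Gamma_1\sqcup\Gamma_2\rangle=\langle\Gamma_1\rangle\langle\Gamma_2\rangle$. The $n$-bracket $\langle\cdot\rangle_n$ is the case $A=1$, $B=-1$, and $$C=\begin{cases}2(2+2q^2+\dots+2q^{n-2}+qb+q^3b+\dots+q^{n-1}b)&n\text{ even},\\3(1+q+\dots+q^{n-1})&n\text{ odd},\end{cases}$$ where $q^n=1$ and (for $n$ even) $b^2=1$. The Penrose polynomial $P(\Gamma,k)$ is the bracket of $\Gamma^\flat_E$ with $A=1$, $B=-1$, $C=k$. *)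

(* Defs.v *)
From HB Require Import structures.
From Stdlib Require Import FunctionalExtensionality.
From mathcomp Require Import all_boot all_order all_algebra.
From mathcomp Require Import qpoly.

Set Implicit Arguments.
Unset Strict Implicit.
Unset Printing Implicit Defensive.

Import GRing.Theory.
Local Open Scope ring_scope.

(* A ribbon graph is given by its half-edges: opp exchanges the two halves of
   an edge, and ccw sends a half-edge to the next one counterclockwise around
   its vertex.  The vertices are the cycles of ccw and the edges the pairs
   {x, opp x}; loops and multiple edges are allowed.  There is no isolated
   vertex to represent, since graphs are connected with an edge. *)
Record ribbon_graph := RibbonGraph {
  halfedge : finType;
  opp : halfedge -> halfedge;
  ccw : halfedge -> halfedge;
  opp_inv : involutive opp;
  opp_neq : forall x, opp x != x;
  ccw_inj : injective ccw;
  ribbon_connected :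
    forall x y, connect [rel u v | (v == opp u) || (v == ccw u)] x y;
  ribbon_nonempty : (0 < #|halfedge|)%N
}.

Arguments opp {r} x.
Arguments ccw {r} x.

(* A set of edges is represented by the set of their half-edges.  Every vertex
   carries exactly one half-edge of the matching, so in particular no matching
   edge is a loop. *)
Record pm_graph := PMGraph {
  pm_ribbon :> ribbon_graph;
  matching : {set halfedge pm_ribbon};
  matching_opp : forall x, (opp x \in matching) = (x \in matching);
  matching_perfect :
    forall x : halfedge pm_ribbon,
      #|[set y in matching | fconnect ccw x y]| = 1%N
}.

Record trivalent_pm_graph := TrivalentPMGraph {
  trivalent_pm :> pm_graph;
  trivalent_degree : forall x : halfedge trivalent_pm, order ccw x = 3%N
}.

Section Blowup.
Variable G : ribbon_graph.

(* The circle vertex at the end of the half-edge x carries three half-edges: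
   (x, 0), the outer one, along x itself;
   (x, 1), the arc going counterclockwise along the circle, towards ccw x;
   (x, 2), the arc going clockwise, towards the predecessor of x.
   This is also their counterclockwise order. *)
Definition blowup_half : finType := (halfedge G * 'I_3)%type.

Definition blowup_opp (p : blowup_half) : blowup_half :=
  if p.2 == 0 then (opp p.1, 0)
  else if p.2 == 1 then (ccw p.1, 2)
  else (finv ccw p.1, 1).

Definition blowup_ccw (p : blowup_half) : blowup_half := (p.1, p.2 + 1).

Lemma I3P (i : 'I_3) : [\/ i = 0, i = 1 | i = 2].
Proof.
case: i => [[|[|[|//]]]] Hi; [apply: Or31|apply: Or32|apply: Or33];
  exact: val_inj.
Qed.

Lemma blowup_opp_inv : involutive blowup_opp.
Proof.
case=> x i; rewrite /blowup_opp /=.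
case: (I3P i) => -> /=; first by rewrite opp_inv.
  by rewrite (finv_f (@ccw_inj G)).
by rewrite (f_finv (@ccw_inj G)).
Qed.

Lemma blowup_opp_neq p : blowup_opp p != p.
Proof.
case: p => x i; rewrite /blowup_opp /=.
case: (I3P i) => -> /=; rewrite xpair_eqE ?andbF //=.
by rewrite (negbTE (opp_neq x)).
Qed.

Lemma blowup_ccw_inj : injective blowup_ccw.
Proof.
move=> [x i] [y j] E; have /= -> := congr1 fst E.
by have /= /addIr -> := congr1 snd E.
Qed.

Lemma iter_blowup_ccw x i k : iter k blowup_ccw (x, i) = (x, i + k%:R).
Proof. by elim: k => [|k IH]; rewrite ?addr0 //= IH /blowup_ccw /= -addrA -mulrSr. Qed.

Lemma blowup_ccw_fconnect (p q : blowup_half) :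
  fconnect blowup_ccw p q = (q.1 == p.1).
Proof.
case: p q => [x i] [y j] /=; apply/idP/eqP => [/iter_findex|->].
  by rewrite iter_blowup_ccw => /(congr1 fst) /= ->.
have -> : (x, j) = iter (j - i : 'I_3)%R blowup_ccw (x, i).
  by rewrite iter_blowup_ccw natr_Zp addrC subrK.
exact: fconnect_iter.
Qed.

Lemma blowup_degree p : order blowup_ccw p = 3.
Proof.
have inj : injective (fun i : 'I_3 => (p.1, i)) by move=> i j [].
have card3 : #|[set (p.1, i) | i : 'I_3]| = 3%N by rewrite card_imset ?card_ord.
rewrite -[RHS]card3 /order; apply: eq_card => -[y i].
rewrite -[LHS]/(fconnect _ _ _) blowup_ccw_fconnect /=.
by apply/eqP/imsetP => [->|[j _ [-> _]]//]; exists i.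
Qed.

Lemma blowup_connected (p q : blowup_half) :
  connect [rel u v | (v == blowup_opp u) || (v == blowup_ccw u)] p q.
Proof.
set e := [rel u v | _].
have rot_e u v : u.1 = v.1 -> connect e u v.
  move=> uv; have : fconnect blowup_ccw u v by rewrite blowup_ccw_fconnect uv.
  by apply: connect_sub => a b /= /eqP <-; apply: connect1; rewrite /= eqxx orbT.
suff H x y : connect [rel u v | (v == opp u) || (v == ccw u)] x y ->
    connect e (x, 0) (y, 0).
  apply: (connect_trans (rot_e p (p.1, 0) erefl)).
  exact: (connect_trans (H _ _ (ribbon_connected p.1 q.1)) (rot_e (_, _) q erefl)).
case/connectP=> s; elim: s x => [|z s IH] x /=; first by move=> _ ->.
case/andP => /orP[] /eqP-> es yE; apply: connect_trans (IH _ es yE).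
  by apply: connect1; rewrite /= /blowup_opp /= eqxx.
apply: (connect_trans (rot_e (x, 0) (x, 1) erefl)).
apply: (connect_trans _ (rot_e (ccw x, 2) (ccw x, 0) erefl)).
by apply: connect1; rewrite /= /blowup_opp /= eqxx.
Qed.

Lemma blowup_nonempty : (0 < #|blowup_half|)%N.
Proof. by rewrite card_prod card_ord muln_gt0 ribbon_nonempty. Qed.

Definition blowup : ribbon_graph :=
  RibbonGraph blowup_opp_inv blowup_opp_neq blowup_ccw_inj
    blowup_connected blowup_nonempty.

Definition canonical_matching : {set halfedge blowup} :=
  [set p : blowup_half | p.2 == 0].

Lemma canonical_matching_opp (p : halfedge blowup) :
  (opp p \in canonical_matching) = (p \in canonical_matching).
Proof.
case: p => x i; rewrite !inE /= /blowup_opp /=.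
by case: (I3P i) => ->.
Qed.

Lemma canonical_matching_perfect (p : halfedge blowup) :
  #|[set y in canonical_matching | fconnect ccw p y]| = 1%N.
Proof.
rewrite -(cards1 (p.1, 0 : 'I_3)); apply: eq_card => -[y i].
by rewrite !inE blowup_ccw_fconnect /= xpair_eqE andbC.
Qed.

Definition blowup_pm : pm_graph :=
  PMGraph canonical_matching_opp canonical_matching_perfect.

Definition blowup_trivalent_pm : trivalent_pm_graph :=
  @TrivalentPMGraph blowup_pm blowup_degree.

End Blowup.

(* What smoothing produces: a possibly disconnected trivalent perfect matching
   graph on the half-edges in dhalf, together with a number of circles without
   vertices.  Outside dhalf, dopp and drot carry no
   meaning. *)
Record diagram (H : finType) := Diagram {
  dhalf : {set H};
  dopp : H -> H;
  drot : H -> H;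
  dmatching : {set H};
  circles : nat
}.

Definition diagram_of (G : trivalent_pm_graph) : diagram (halfedge G) :=
  Diagram [set: halfedge G] opp ccw (matching G) 0.

Section Smoothing.
Variable H : finType.
Implicit Types (D : diagram H) (f : H -> H) (a b x m : H).

(* Gluing the ends a and b of two edges {a, f a} and {b, f b} leaves the edge
   {f a, f b}; the glued ends form a pair on their own, to be discarded. *)
Definition splice f a b x : H :=
  if x == a then b else if x == b then a
  else if x == f a then f b else if x == f b then f a else f x.

(* Gluing both ends of a single edge closes it into a circle. *)
Definition join a b D : diagram H :=
  Diagram (dhalf D) (splice (dopp D) a b) (drot D) (dmatching D)
    (circles D + (dopp D a == b)).

Definition remove_edge m m' D : diagram H :=
  let vertex x := [set x; drot D x; drot D (drot D x)] in
  Diagram (dhalf D :\: (vertex m :|: vertex m')) (dopp D) (drot D)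
    (dmatching D :\: [set m; m']) (circles D).

(* The matching edge is {m, m'}, with m at its top vertex, where m points
   down: counterclockwise from m come up-right and up-left.  At the bottom
   vertex m' points up: counterclockwise from m' come down-left and
   down-right. *)
Definition smoothing0 m D : diagram H :=
  let m' := dopp D m in
  let ur := drot D m in let ul := drot D ur in
  let dl := drot D m' in let dr := drot D dl in
  remove_edge m m' (join ur dr (join ul dl D)).

Definition smoothing1 m D : diagram H :=
  let m' := dopp D m in
  let ur := drot D m in let ul := drot D ur in
  let dl := drot D m' in let dr := drot D dl in
  remove_edge m m' (join ur dl (join ul dr D)).

End Smoothing.

Section Bracket.
Variables (R : comNzRingType) (A B C : R).

(* Each step expands at an arbitrarily chosen matching edge.  That the defining
   relations hold for every matching edge and every disjoint union, and that
   they determine the bracket, is proved in diagram_bracket_skein,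
   diagram_bracket_circles, diagram_bracket_dunion and
   diagram_bracket_unique. *)
Fixpoint bracket_rec (H : finType) (k : nat) (D : diagram H) : R :=
  if k is k'.+1 then
    if [pick m in dmatching D] is Some m then
      A * bracket_rec k' (smoothing0 m D) + B * bracket_rec k' (smoothing1 m D)
    else C ^+ circles D
  else C ^+ circles D.

Definition diagram_bracket (H : finType) (D : diagram H) : R :=
  bracket_rec #|dmatching D| D.

Definition bracket (G : trivalent_pm_graph) : R :=
  diagram_bracket (diagram_of G).

End Bracket.

(* Z[q]/(q^n - 1), and Z[q,b]/(q^n - 1, b^2 - 1) as Zq n [b]/(b^2 - 1). *)
Definition Zq (n : nat) : comNzRingType := {poly %/ ('X^n - 1 : {poly int})}.

Definition Zqb (n : nat) : comNzRingType := {poly %/ ('X^2 - 1 : {poly Zq n})}.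

Definition q_odd (n : nat) : Zq n := in_qpoly _ 'X.
Definition q_even (n : nat) : Zqb n := qpolyC _ (q_odd n).
Definition b_even (n : nat) : Zqb n := in_qpoly _ 'X.

Definition nbracket_odd (n : nat) (G : trivalent_pm_graph) : Zq n :=
  bracket 1 (-1) (3 * \sum_(i < n) q_odd n ^+ i) G.

Definition nbracket_even (n : nat) (G : trivalent_pm_graph) : Zqb n :=
  let q := q_even n in let b := b_even n in
  bracket 1 (-1)
    (2 * (\sum_(i < n./2) 2 * q ^+ (2 * i)
          + \sum_(i < n./2) q ^+ (2 * i + 1) * b)) G.

(* Substitution of integers for the variables in the representative of minimal
   degree; a ring morphism if q ^+ n = 1 and b ^+ 2 = 1 (eval_q_morphism,
   eval_qb_morphism). *)
Definition eval_q (n : nat) (q : int) (z : Zq n) : int := (polyn z).[q].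

Definition eval_qb (n : nat) (q b : int) (z : Zqb n) : int :=
  (map_poly (@eval_q n q) (polyn z)).[b].

Definition penrose (G : ribbon_graph) : {poly int} :=
  bracket 1 (-1) 'X (blowup_trivalent_pm G).

Local Ltac no_if t :=
  lazymatch t with context [if _ then _ else _] => fail | _ => idtac end.
Local Ltac splice_cases :=
  repeat (first [congruence
    | match goal with |- context [?x == ?y] =>
        no_if x; no_if y; case: (x =P y) => ? end]);
  try congruence; try by [].

Section SmoothingTheory.
Variable H : finType.
Implicit Types (D : diagram H) (f : H -> H) (a b c d x m n : H).

Lemma splice_inv f a b :
  involutive f -> (forall x, f x <> x) -> a <> b -> involutive (splice f a b).
Proof.
move=> fK fN ab x; rewrite /splice.
move: (fK a) (fK b) (fK x) (fN a) (fN b) (fN x) => *.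
splice_cases.
Qed.

Lemma splice_neq f a b :
  involutive f -> (forall x, f x <> x) -> a <> b ->
  forall x, splice f a b x <> x.
Proof.
move=> fK fN ab x; rewrite /splice.
move: (fK a) (fK b) (fK x) (fN a) (fN b) (fN x) => *.
splice_cases.
Qed.

Lemma splice_sym f a b : involutive f -> a <> b -> splice f a b =1 splice f b a.
Proof.
move=> fK ab x; rewrite /splice; move: (fK a) (fK b) => *; splice_cases.
Qed.

Lemma splice_comm f a b c d :
  involutive f -> (forall x, f x <> x) -> uniq [:: a; b; c; d] ->
  splice (splice f a b) c d =1 splice (splice f c d) a b.
Proof.
rewrite /= !inE !negb_or => fK fN.
case/and4P=> /and3P[/eqP ? /eqP ? /eqP ?] /andP[/eqP ? /eqP ?] /eqP ? _ x.
rewrite /splice.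
move: (fK a) (fK b) (fK c) (fK d) (fK x) => *.
move: (fN a) (fN b) (fN c) (fN d) (fN x) => *.
splice_cases.
Qed.

Lemma splice_circles f a b c d :
  involutive f -> (forall x, f x <> x) -> uniq [:: a; b; c; d] ->
  ((f a == b) + (splice f a b c == d) =
   (f c == d) + (splice f c d a == b))%N.
Proof.
rewrite /= !inE !negb_or => fK fN.
case/and4P=> /and3P[/eqP ? /eqP ? /eqP ?] /andP[/eqP ? /eqP ?] /eqP ? _.
rewrite /splice.
move: (fK a) (fK b) (fK c) (fK d) => *.
move: (fN a) (fN b) (fN c) (fN d) => *.
splice_cases.
Qed.

Record diagram_wf D : Prop := DiagramWf {
  wf_oppK : involutive (dopp D);
  wf_opp_neq : forall x, dopp D x <> x;
  wf_half_opp : forall x, x \in dhalf D -> dopp D x \in dhalf D;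
  wf_half_rot : forall x, x \in dhalf D -> drot D x \in dhalf D;
  wf_rot3 : forall x, x \in dhalf D -> drot D (drot D (drot D x)) = x;
  wf_matching_half : {subset dmatching D <= dhalf D};
  wf_matching_opp : forall x, x \in dmatching D -> dopp D x \in dmatching D;
  wf_matching1 : forall x, x \in dhalf D ->
    ((x \in dmatching D) + (drot D x \in dmatching D)
     + (drot D (drot D x) \in dmatching D) = 1)%N
}.

Lemma join_sym a b D : diagram_wf D -> a <> b -> join a b D = join b a D.
Proof.
move=> wf ab; rewrite /join; congr Diagram.
  by apply: functional_extensionality => x; apply: splice_sym => //; case: wf.
by congr addn; congr nat_of_bool; rewrite (canF_eq (wf_oppK wf)) eq_sym.
Qed.

Lemma join_comm a b c d D : diagram_wf D -> uniq [:: a; b; c; d] ->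
  join a b (join c d D) = join c d (join a b D).
Proof.
move=> [fK fN _ _ _ _ _ _] U; rewrite /join /=; congr Diagram.
  apply: functional_extensionality => x; rewrite splice_comm //.
  by move: U; rewrite (uniq_catC [:: c; d] [:: a; b]).
rewrite -!addnA; congr addn; apply/esym; exact: splice_circles.
Qed.

Lemma wf_join a b D : diagram_wf D -> a <> b ->
  a \in dhalf D :\: dmatching D -> b \in dhalf D :\: dmatching D ->
  diagram_wf (join a b D).
Proof.
move=> wf ab; rewrite !inE => /andP[aM aH] /andP[bM bH].
have [fK fN hO hR r3 MH MO M1] := wf.
split=> //=.
- exact: splice_inv.
- exact: splice_neq.
- move=> x xH; rewrite /splice; do ![case: eqP => ? //]; exact: hO.
- move=> x xM; rewrite /splice; case: eqP => [xa|_]; first by rewrite -xa xM in aM.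
  case: eqP => [xb|_]; first by rewrite -xb xM in bM.
  case: eqP => [xa|_]; first by case/negP: aM; rewrite -(fK a) -xa MO.
  case: eqP => [xb|_]; first by case/negP: bM; rewrite -(fK b) -xb MO.
  exact: MO.
Qed.

(* The two non-matching half-edges at the vertex of m. *)
Definition leg D (p : bool) m := if p then drot D m else drot D (drot D m).
Arguments leg : simpl never.

Definition glue (s : bool) m m' D :=
  join (leg D true m) (leg D s m') (join (leg D false m) (leg D (~~ s) m') D).

Definition smoothing (s : bool) m D :=
  remove_edge m (dopp D m) (glue s m (dopp D m) D).

Lemma smoothingE s m D :
  smoothing s m D = if s then smoothing1 m D else smoothing0 m D.
Proof. by case: s. Qed.

Section Legs.
Variable D : diagram H.
Hypothesis wf : diagram_wf D.

Lemma leg_half p m : m \in dmatching D -> leg D p m \in dhalf D :\: dmatching D.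
Proof.
move=> mM; have mH := wf_matching_half wf mM.
have := wf_matching1 wf mH; rewrite mM !inE /leg.
case: p; rewrite !(wf_half_rot wf) //.
  by case: (drot D m \in _).
by case: (drot D (drot D m) \in _); rewrite // addnC.
Qed.

Lemma rot_inj_half x y :
  x \in dhalf D -> y \in dhalf D -> drot D x = drot D y -> x = y.
Proof. by move=> xH yH E; rewrite -(wf_rot3 wf xH) E (wf_rot3 wf yH). Qed.

Lemma leg_inj p q m n : m \in dmatching D -> n \in dmatching D ->
  (leg D p m == leg D q n) = (p == q) && (m == n).
Proof.
move=> mM nM.
have mH := wf_matching_half wf mM; have nH := wf_matching_half wf nM.
have rH x (xH : x \in dhalf D) := wf_half_rot wf xH.
apply/eqP/andP => [|[/eqP-> /eqP->]//].
have rotN x : x \in dmatching D -> drot D x \notin dmatching D.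
  by move=> xM; have := leg_half true xM; rewrite inE => /andP[].
case: p q => [] []; rewrite /leg /= => E.
- by rewrite (rot_inj_half mH nH E).
- by have := rotN _ nM; rewrite -(rot_inj_half mH (rH _ nH) E) mM.
- by have := rotN _ mM; rewrite (rot_inj_half (rH _ mH) nH E) nM.
- by rewrite (rot_inj_half mH nH (rot_inj_half (rH _ mH) (rH _ nH) E)).
Qed.

Lemma leg_join p m a b : leg (join a b D) p m = leg D p m.
Proof. by []. Qed.

Lemma opp_leg_matching p m n :
  m \in dmatching D -> n \in dmatching D -> (leg D p m == n) = false.
Proof.
move=> mM nM; apply/eqP => E.
by have := leg_half p mM; rewrite inE E nM.
Qed.

End Legs.

Lemma wf_glue s m D : diagram_wf D -> m \in dmatching D ->
  diagram_wf (glue s m (dopp D m) D).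
Proof.
move=> wf mM; have m'M := wf_matching_opp wf mM.
have mm' : (m == dopp D m) = false by apply/eqP => E; apply: (wf_opp_neq wf (x:=m)).
have wf1 : diagram_wf (join (leg D false m) (leg D (~~ s) (dopp D m)) D).
  apply: wf_join => //; rewrite ?leg_half //.
  by apply/eqP; rewrite leg_inj // mm' andbF.
rewrite /glue; apply: wf_join => //=; rewrite ?leg_half //.
by apply/eqP; rewrite leg_inj // mm' andbF.
Qed.

Lemma join_opp_matching a b D n : diagram_wf D ->
  a \in dhalf D :\: dmatching D -> b \in dhalf D :\: dmatching D ->
  n \in dmatching D -> dopp (join a b D) n = dopp D n.
Proof.
move=> wf; rewrite !inE => /andP[aM aH] /andP[bM bH] nM.
rewrite /join /= /splice.
case: eqP => [xa|_]; first by rewrite -xa nM in aM.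
case: eqP => [xb|_]; first by rewrite -xb nM in bM.
have fK := wf_oppK wf; have MO := wf_matching_opp wf nM.
case: eqP => [xa|_]; first by case/negP: aM; rewrite -(fK a) -xa MO.
case: eqP => [xb|_]; first by case/negP: bM; rewrite -(fK b) -xb MO.
by [].
Qed.

Lemma glue_opp_matching s m D n : diagram_wf D -> m \in dmatching D ->
  n \in dmatching D -> dopp (glue s m (dopp D m) D) n = dopp D n.
Proof.
move=> wf mM nM; have m'M := wf_matching_opp wf mM.
have mm' : (m == dopp D m) = false by apply/eqP => E; apply: (wf_opp_neq wf (x:=m)).
rewrite /glue join_opp_matching ?join_opp_matching //=; rewrite ?leg_half //.
apply: wf_join => //; rewrite ?leg_half //.
by apply/eqP; rewrite leg_inj // mm' andbF.
Qed.

Lemma smoothing_opp_matching s m D n : diagram_wf D -> m \in dmatching D ->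
  n \in dmatching D -> dopp (smoothing s m D) n = dopp D n.
Proof. exact: glue_opp_matching. Qed.

Lemma glueC s m D : diagram_wf D -> m \in dmatching D ->
  glue s m (dopp D m) D =
  join (leg D false m) (leg D (~~ s) (dopp D m))
    (join (leg D true m) (leg D s (dopp D m)) D).
Proof.
move=> wf mM; have m'M := wf_matching_opp wf mM.
have mm' : (m == dopp D m) = false by apply/eqP => E; apply: (wf_opp_neq wf (x:=m)).
have m'm : (dopp D m == m) = false by rewrite eq_sym.
rewrite /glue join_comm //.
by rewrite /= !inE !leg_inj // mm' m'm ?andbF /=; case: s.
Qed.

Lemma wf_remove_edge m D (P := [set m; dopp D m])
    (V := [set m; drot D m; drot D (drot D m)] :|:
          [set dopp D m; drot D (dopp D m); drot D (drot D (dopp D m))]) :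
  diagram_wf D -> m \in dmatching D ->
  {in V, forall x, dopp D x \in V} ->
  diagram_wf (remove_edge m (dopp D m) D).
Proof.
move=> wf mM VO; have m'M := wf_matching_opp wf mM.
have mH := wf_matching_half wf mM; have m'H := wf_matching_half wf m'M.
have [fK fN hO hR r3 MH MO M1] := wf.
have VH x : x \in V -> x \in dhalf D.
  by rewrite !inE => /orP[/orP[/orP[]|]|/orP[/orP[]|]] /eqP->; rewrite ?hR.
have VR x : x \in V -> drot D x \in V.
  by rewrite !inE => /orP[/orP[/orP[]|]|/orP[/orP[]|]] /eqP->;
     rewrite ?r3 ?eqxx ?orbT.
have MV x : x \in dmatching D -> x \in V -> x \in P.
  move=> xM; rewrite !inE.
  have E n p : n \in dmatching D -> (x == leg D p n) = false.
    by move=> nM; rewrite eq_sym opp_leg_matching.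
  have := E m true mM; have := E m false mM.
  have := E _ true m'M; have := E _ false m'M; rewrite /leg.
  by do 4![move=> ->]; rewrite !orbF.
have PV x : x \in P -> x \in V by rewrite !inE => /orP[] ->; rewrite ?orbT.
have PM x : x \in P -> x \in dmatching D by rewrite !inE => /orP[] /eqP->.
have inM x : x \in dhalf D :\: V -> (x \in dmatching D :\: P) = (x \in dmatching D).
  rewrite !in_setD => /andP[xV xH].
  by have [/PV xV'|//] := boolP (x \in P); rewrite xV' in xV.
have HR x : x \in dhalf D :\: V -> drot D x \in dhalf D :\: V.
  rewrite !in_setD => /andP[xV xH]; rewrite hR // andbT.
  by apply: contra xV => /VR/VR; rewrite r3.
split=> //=.
- move=> x; rewrite -/V !in_setD => /andP[xV xH]; rewrite hO // andbT.
  by apply: contra xV => /VO; rewrite fK.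
- by move=> x; rewrite -/V in_setD => /andP[_ /r3].
- move=> x; rewrite -/V -/P !in_setD => /andP[xP xM]; rewrite MH // andbT.
  by apply: contra xP; exact: MV.
- move=> x; rewrite -/P !in_setD => /andP[xP xM]; rewrite MO // andbT.
  apply: contra xP; rewrite !inE => /orP[]/eqP E; last first.
    by rewrite (can_inj fK E) eqxx.
  by rewrite -E fK eqxx orbT.
- move=> x; rewrite -/V -/P => xHV.
  by rewrite !inM ?HR //; apply: M1; move: xHV; rewrite in_setD => /andP[].
Qed.

Lemma wf_smoothing s m D : diagram_wf D -> m \in dmatching D ->
  diagram_wf (smoothing s m D).
Proof.
move=> wf mM; have wfg := wf_glue s wf mM.
have E := glue_opp_matching s wf mM mM.
rewrite /smoothing -{1}E; apply: wf_remove_edge => //; rewrite E.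
have gK := wf_oppK wfg; have m'M := wf_matching_opp wf mM.
have g1 : dopp (glue s m (dopp D m) D) (leg D true m) = leg D s (dopp D m).
  by rewrite /glue /= /splice eqxx.
have g2 : dopp (glue s m (dopp D m) D) (leg D false m) = leg D (~~ s) (dopp D m).
  by rewrite glueC //= {1}/splice eqxx.
have g1' := canLR gK (esym g1); have g2' := canLR gK (esym g2).
have ED : drot (glue s m (dopp D m) D) = drot D by [].
have LV p n : n \in [set m; dopp D m] ->
  leg D p n \in [set m; drot D m; drot D (drot D m)] :|:
    [set dopp D m; drot D (dopp D m); drot D (drot D (dopp D m))].
  by rewrite !inE => /orP[]/eqP->; case: p; rewrite /leg eqxx ?orbT.
have mP : m \in [set m; dopp D m] by rewrite !inE eqxx.
have m'P : dopp D m \in [set m; dopp D m] by rewrite !inE eqxx orbT.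
rewrite ED => x.
case/setUP=> [/setUP[/set2P[]|/set1P]|/setUP[/set2P[]|/set1P]] ->.
- by rewrite E !inE eqxx ?orbT.
- by rewrite g1 LV.
- by rewrite g2 LV.
- by rewrite (canLR gK (esym E)) !inE eqxx.
- by case: (s) g1' g2' => /= [-> _|_ ->]; exact: LV.
- by case: (s) g1' g2' => /= [_ ->|-> _]; exact: LV.
Qed.

Lemma glue_comm s t m n D : diagram_wf D ->
  m \in dmatching D -> n \in dmatching D -> n != m -> n != dopp D m ->
  glue s m (dopp D m) (glue t n (dopp D n) D) =
  glue t n (dopp D n) (glue s m (dopp D m) D).
Proof.
move=> wf mM nM nm nm'.
have fK := wf_oppK wf.
have m'M := wf_matching_opp wf mM; have n'M := wf_matching_opp wf nM.
have [mm' nn'] : (m == dopp D m) = false /\ (n == dopp D n) = false.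
  by split; apply/eqP => E; [apply: (wf_opp_neq wf (x := m))
                            |apply: (wf_opp_neq wf (x := n))].
have mn' : (m == dopp D n) = false.
  by rewrite -(can_eq fK) fK eq_sym (negbTE nm').
have m'n' : (dopp D m == dopp D n) = false.
  by rewrite (can_eq fK) eq_sym (negbTE nm).
have mn : (m == n) = false by rewrite eq_sym (negbTE nm).
have m'n : (dopp D m == n) = false by rewrite eq_sym (negbTE nm').
have U p q r u : uniq [:: leg D p m; leg D q (dopp D m); leg D r n; leg D u (dopp D n)].
  by rewrite /= !inE !leg_inj // mm' nn' mn' m'n' mn m'n !andbF.
rewrite /glue !leg_join.
set a := leg D true m; set b := leg D s _; set c := leg D false m.
set d := leg D (~~ s) _.
set a' := leg D true n; set b' := leg D t _; set c' := leg D false n.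
set d' := leg D (~~ t) _.
have wfj r u : diagram_wf (join (leg D r n) (leg D u (dopp D n)) D).
  apply: wf_join => //; rewrite ?leg_half //.
  by apply/eqP; rewrite leg_inj // nn' andbF.
have wfj' r u : diagram_wf (join (leg D r m) (leg D u (dopp D m)) D).
  apply: wf_join => //; rewrite ?leg_half //.
  by apply/eqP; rewrite leg_inj // mm' andbF.
have wfjj r u r' u' : diagram_wf (join (leg D r m) (leg D u (dopp D m))
    (join (leg D r' n) (leg D u' (dopp D n)) D)).
  apply: wf_join => //; rewrite ?leg_half //.
  by apply/eqP; rewrite leg_inj // mm' andbF.
have -> : join c d (join a' b' (join c' d' D)) =
    join a' b' (join c d (join c' d' D)).
  by apply: join_comm; [exact: wfj|exact: U].
have -> : join a b (join a' b' (join c d (join c' d' D))) =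
    join a' b' (join a b (join c d (join c' d' D))).
  by apply: join_comm; [exact: wfjj|exact: U].
have -> : join c d (join c' d' D) = join c' d' (join c d D).
  by apply: join_comm; [exact: wf|exact: U].
by congr join; apply: join_comm; [exact: wfj'|exact: U].
Qed.

Lemma smoothing_comm s t m n D : diagram_wf D ->
  m \in dmatching D -> n \in dmatching D -> n != m -> n != dopp D m ->
  smoothing s m (smoothing t n D) = smoothing t n (smoothing s m D).
Proof.
move=> wf mM nM nm nm'; rewrite {1 3}/smoothing !smoothing_opp_matching //.
have -> s1 m1 : glue s1 m1 (dopp D m1) (smoothing t n D) =
  remove_edge n (dopp D n) (glue s1 m1 (dopp D m1) (glue t n (dopp D n) D)) by [].
have -> s1 m1 : glue s1 m1 (dopp D m1) (smoothing s m D) =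
  remove_edge m (dopp D m) (glue s1 m1 (dopp D m1) (glue s m (dopp D m) D)) by [].
rewrite glue_comm // /remove_edge /= !setDDl.
by congr Diagram; [congr (_ :\: _)|congr (_ :\: _)]; rewrite setUC.
Qed.

Lemma smoothing_opp s m D : diagram_wf D -> m \in dmatching D ->
  smoothing s (dopp D m) D = smoothing s m D.
Proof.
move=> wf mM; have m'M := wf_matching_opp wf mM.
have mm' : (m == dopp D m) = false by apply/eqP => E; apply: (wf_opp_neq wf (x:=m)).
have m'm : (dopp D m == m) = false by rewrite eq_sym.
have wfj p q : diagram_wf (join (leg D p m) (leg D q (dopp D m)) D).
  apply: wf_join => //; rewrite ?leg_half //.
  by apply/eqP; rewrite leg_inj // mm' andbF.
have N p q : leg D p (dopp D m) <> leg D q m.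
  by apply/eqP; rewrite leg_inj // m'm andbF.
rewrite /smoothing wf_oppK //.
have -> : glue s (dopp D m) m D = glue s m (dopp D m) D.
  rewrite {1}/glue [join (leg D false _) _ _]join_sym //.
  rewrite [LHS]join_sym //.
  by case: s; rewrite //= [in RHS]glueC.
rewrite /remove_edge; congr Diagram; congr (_ :\: _); exact: setUC.
Qed.

Lemma smoothing_matching s m D :
  dmatching (smoothing s m D) = dmatching D :\: [set m; dopp D m].
Proof. by []. Qed.

Lemma card_smoothing s m D : m \in dmatching D ->
  (#|dmatching (smoothing s m D)| < #|dmatching D|)%N.
Proof.
move=> mM; apply: proper_card; rewrite properE subsetDl /=.
by apply/subsetPn; exists m; rewrite // !inE eqxx.
Qed.

End SmoothingTheory.

Section BracketTheory.
Variables (R : comNzRingType) (A B C : R).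
Local Notation rec := (@bracket_rec R A B C _).
Local Notation br := (@diagram_bracket R A B C _).

Lemma bracket_rec_fuel (H : finType) k l (D : diagram H) :
  (#|dmatching D| <= k)%N -> (#|dmatching D| <= l)%N -> rec k D = rec l D.
Proof.
elim: k l D => [|k IH] [|l] D //= Dk Dl; case: pickP => // m mM.
- by move: Dk; rewrite leqn0 cards_eq0 => /eqP E; rewrite E inE in mM.
- by move: Dl; rewrite leqn0 cards_eq0 => /eqP E; rewrite E inE in mM.
have lt s := card_smoothing s mM.
by congr (_ * _ + _ * _); apply: IH; rewrite -ltnS;
  [exact: leq_trans (lt false) Dk|exact: leq_trans (lt false) Dl
  |exact: leq_trans (lt true) Dk|exact: leq_trans (lt true) Dl].
Qed.

Lemma bracket_rec_enough (H : finType) k (D : diagram H) :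
  (#|dmatching D| <= k)%N -> rec k D = br D.
Proof. by move=> Dk; exact: bracket_rec_fuel. Qed.

Lemma diagram_bracketE (H : finType) (D : diagram H) :
  br D = if [pick m in dmatching D] is Some m
    then A * br (smoothing0 m D) + B * br (smoothing1 m D) else C ^+ circles D.
Proof.
rewrite -(@bracket_rec_enough _ #|dmatching D|.+1) //=; case: pickP => // m mM.
by rewrite !bracket_rec_enough // ltnW //;
  [exact: (card_smoothing true mM)|exact: (card_smoothing false mM)].
Qed.

Lemma diagram_bracket_circles (H : finType) (D : diagram H) :
  dmatching D = set0 -> br D = C ^+ circles D.
Proof.
by move=> D0; rewrite diagram_bracketE; case: pickP => // m; rewrite D0 inE.
Qed.

Theorem diagram_bracket_skein (H : finType) (D : diagram H) (m : H) :
  diagram_wf D -> m \in dmatching D ->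
  br D = A * br (smoothing0 m D) + B * br (smoothing1 m D).
Proof.
move: {-1}#|dmatching D| (leqnn #|dmatching D|) => k.
elim: k D m => [|k IH] D m Dk wf mM.
  by move: Dk; rewrite leqn0 cards_eq0 => /eqP E; rewrite E inE in mM.
rewrite diagram_bracketE; case: pickP => [n nM|/(_ m)]; last by rewrite mM.
rewrite -!(smoothingE false) -!(smoothingE true).
have [->//|nm] := eqVneq n m.
have [->|nm'] := eqVneq n (dopp D m); first by rewrite !smoothing_opp.
have fK := wf_oppK wf.
have mn : m != n by rewrite eq_sym.
have mn' : m != dopp D n by rewrite -(can_eq fK) fK eq_sym.
have lt s p (pM : p \in dmatching D) :=
  leq_trans (card_smoothing s pM) Dk.
have mS s : m \in dmatching (smoothing s n D).
  by rewrite smoothing_matching !inE negb_or mn mn'.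
have nS s : n \in dmatching (smoothing s m D).
  by rewrite smoothing_matching !inE negb_or nm nm'.
have E s : br (smoothing s n D) =
    A * br (smoothing false m (smoothing s n D))
    + B * br (smoothing true m (smoothing s n D)).
  by rewrite !smoothingE; rewrite -smoothingE; apply: IH;
    [exact: lt|exact: wf_smoothing|exact: mS].
have E' s : br (smoothing s m D) =
    A * br (smoothing false n (smoothing s m D))
    + B * br (smoothing true n (smoothing s m D)).
  by rewrite !smoothingE; rewrite -smoothingE; apply: IH;
    [exact: lt|exact: wf_smoothing|exact: nS].
rewrite !E !E' !(smoothing_comm _ _ wf mM nM nm nm').
by rewrite !mulrDr !mulrA (mulrC B A) addrACA.
Qed.

Theorem diagram_bracket_unique (H : finType) (F : diagram H -> R) :
  (forall D m, diagram_wf D -> m \in dmatching D ->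
     F D = A * F (smoothing0 m D) + B * F (smoothing1 m D)) ->
  (forall D, dmatching D = set0 -> F D = C ^+ circles D) ->
  forall D, diagram_wf D -> F D = br D.
Proof.
move=> skein circ D; move: {-1}#|dmatching D| (leqnn #|dmatching D|) => k.
elim: k D => [|k IH] D Dk wf.
  move: Dk; rewrite leqn0 cards_eq0 => /eqP E.
  by rewrite circ // diagram_bracket_circles.
have [E|[m mM]] := set_0Vmem (dmatching D).
  by rewrite circ // diagram_bracket_circles.
rewrite (skein D m) // (diagram_bracket_skein wf mM).
rewrite -(smoothingE false) -(smoothingE true).
by rewrite !IH //; try exact: wf_smoothing;
  exact: leq_trans (card_smoothing _ mM) Dk.
Qed.

End BracketTheory.

Lemma diagram_of_wf (G : trivalent_pm_graph) : diagram_wf (diagram_of G).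
Proof.
have deg := @trivalent_degree G; have inj := @ccw_inj G.
have r3 (x : halfedge G) : ccw (ccw (ccw x)) = x.
  by have := iter_order inj x; rewrite deg.
split=> //=.
- exact: opp_inv.
- by move=> x; apply/eqP; exact: opp_neq.
- by move=> x xM; rewrite matching_opp.
move=> x _; rewrite -(matching_perfect x).
have U := orbit_uniq ccw x; rewrite /orbit deg /= in U.
have -> : #|[set y in matching G | fconnect ccw x y]| =
    #|[seq y <- [:: x; ccw x; ccw (ccw x)] | y \in matching G]|.
  by apply: eq_card => y; rewrite !inE mem_filter fconnect_orbit /orbit deg.
have /card_uniqP-> : uniq [seq y <- [:: x; ccw x; ccw (ccw x)] | y \in matching G].
  exact: filter_uniq.
by rewrite size_filter /= addn0 addnA.
Qed.

Definition dunion (H1 H2 : finType) (D1 : diagram H1) (D2 : diagram H2) :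
    diagram (H1 + H2)%type :=
  Diagram
    [set x | match x with inl y => y \in dhalf D1 | inr y => y \in dhalf D2 end]
    (fun x => match x with inl y => inl (dopp D1 y) | inr y => inr (dopp D2 y) end)
    (fun x => match x with inl y => inl (drot D1 y) | inr y => inr (drot D2 y) end)
    [set x | match x with inl y => y \in dmatching D1
                        | inr y => y \in dmatching D2 end]
    (circles D1 + circles D2).

Section DisjointUnion.
Variables (H1 H2 : finType).

Lemma dunion_wf (D1 : diagram H1) (D2 : diagram H2) :
  diagram_wf D1 -> diagram_wf D2 -> diagram_wf (dunion D1 D2).
Proof.
move=> [fK fN hO hR r3 MH MO M1] [fK' fN' hO' hR' r3' MH' MO' M1'].
split.
- by case=> x /=; rewrite ?fK ?fK'.
- by case=> x /= [] //; [exact: fN|exact: fN'].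
- by case=> x; rewrite !inE; [exact: hO|exact: hO'].
- by case=> x; rewrite !inE; [exact: hR|exact: hR'].
- by case=> x; rewrite !inE /= => xH; rewrite ?r3 ?r3'.
- by case=> x; rewrite !inE; [exact: MH|exact: MH'].
- by case=> x; rewrite !inE; [exact: MO|exact: MO'].
- by case=> x; rewrite !inE /=; [exact: M1|exact: M1'].
Qed.

Lemma join_dunionl (D1 : diagram H1) (D2 : diagram H2) a b :
  join (inl a) (inl b) (dunion D1 D2) = dunion (join a b D1) D2.
Proof.
rewrite /join /dunion; congr Diagram; last by rewrite /= addnAC.
have E (x y : H1) : (inl x == inl y :> H1 + H2) = (x == y) by [].
by apply: functional_extensionality => -[] x; rewrite /splice //= !E;
  do !case: ifP.
Qed.

Lemma join_dunionr (D1 : diagram H1) (D2 : diagram H2) a b :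
  join (inr a) (inr b) (dunion D1 D2) = dunion D1 (join a b D2).
Proof.
rewrite /join /dunion; congr Diagram; last by rewrite /= addnA.
have E (x y : H2) : (inr x == inr y :> H1 + H2) = (x == y) by [].
by apply: functional_extensionality => -[] x; rewrite /splice //= !E;
  do !case: ifP.
Qed.

Lemma smoothing_dunionl s (D1 : diagram H1) (D2 : diagram H2) m :
  smoothing s (inl m) (dunion D1 D2) = dunion (smoothing s m D1) D2.
Proof.
have L D (p : bool) n : leg (dunion D D2) p (inl n) = inl (leg D p n).
  by case: p.
rewrite /smoothing /glue /= !(L, join_dunionl).
by rewrite /remove_edge /dunion /=; congr Diagram; apply/setP => -[] x; rewrite !inE.
Qed.

Lemma smoothing_dunionr s (D1 : diagram H1) (D2 : diagram H2) m :
  smoothing s (inr m) (dunion D1 D2) = dunion D1 (smoothing s m D2).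
Proof.
have L D (p : bool) n : leg (dunion D1 D) p (inr n) = inr (leg D p n).
  by case: p.
rewrite /smoothing /glue /= !(L, join_dunionr).
by rewrite /remove_edge /dunion /=; congr Diagram; apply/setP => -[] x; rewrite !inE.
Qed.

Theorem diagram_bracket_dunion (R : comNzRingType) (A B C : R)
    (D1 : diagram H1) (D2 : diagram H2) :
  diagram_wf D1 -> diagram_wf D2 ->
  diagram_bracket A B C (dunion D1 D2) =
  diagram_bracket A B C D1 * diagram_bracket A B C D2.
Proof.
move: {-1}(_ + _)%N (leqnn (#|dmatching D1| + #|dmatching D2|)) => k.
elim: k D1 D2 => [|k IH] D1 D2 Dk wf1 wf2.
  move: Dk; rewrite leqn0 addn_eq0 !cards_eq0 => /andP[/eqP E1 /eqP E2].
  rewrite !diagram_bracket_circles //= ?exprD //.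
  by apply/setP => -[] x; rewrite !inE ?E1 ?E2 inE.
have wf := dunion_wf wf1 wf2.
have [E1|[m mM]] := set_0Vmem (dmatching D1); last first.
  have mM' : inl m \in dmatching (dunion D1 D2) by rewrite inE.
  rewrite (diagram_bracket_skein A B C wf mM') (diagram_bracket_skein A B C wf1 mM).
  rewrite -!(smoothingE false) -!(smoothingE true) !smoothing_dunionl.
  rewrite !IH ?mulrDl ?mulrA //; try exact: wf_smoothing;
    rewrite -ltnS; apply: leq_trans Dk; rewrite ltn_add2r; exact: card_smoothing.
have [E2|[m mM]] := set_0Vmem (dmatching D2); last first.
  have mM' : inr m \in dmatching (dunion D1 D2) by rewrite inE.
  rewrite (diagram_bracket_skein A B C wf mM') (diagram_bracket_skein A B C wf2 mM).
  rewrite -!(smoothingE false) -!(smoothingE true) !smoothing_dunionr.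
  rewrite !IH ?mulrDr ?[_ * (A * _)]mulrCA ?[_ * (B * _)]mulrCA //;
    try exact: wf_smoothing;
    rewrite -ltnS; apply: leq_trans Dk; rewrite ltn_add2l; exact: card_smoothing.
rewrite !diagram_bracket_circles //= ?exprD //.
by apply/setP => -[] x; rewrite !inE ?E1 ?E2 inE.
Qed.

End DisjointUnion.

Section Eval.
Variables (n : nat) (n_gt0 : (0 < n)%N).

Lemma mk_monic_Xn_sub1 (S : comNzRingType) m :
  (0 < m)%N -> mk_monic ('X^m - 1 : {poly S}) = 'X^m - 1.
Proof.
move=> m_gt0; rewrite /mk_monic -(polyC1 S) size_XnsubC // ltnS m_gt0.
by rewrite monicXnsubC.
Qed.

Lemma eval_q_morphism (q : int) (q1 : q ^+ n = 1) :
  zmod_morphism (@eval_q n q) /\ monoid_morphism (@eval_q n q).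
Proof.
have evm (p : {poly int}) : (Pdiv.CommonRing.rmodp p (mk_monic ('X^n - 1))).[q] = p.[q].
  have mon := monic_mk_monic ('X^n - 1 : {poly int}).
  rewrite {2}(Pdiv.RingMonic.rdivp_eq mon p) hornerD hornerM.
  by rewrite mk_monic_Xn_sub1 // !hornerE q1 subrr mulr0 add0r.
split; first by move=> x y; rewrite /eval_q raddfB hornerD hornerN.
by split; rewrite /eval_q /= ?hornerC // => x y; rewrite evm hornerM.
Qed.

Lemma eval_qb_morphism (q b : int) (q1 : q ^+ n = 1) (b1 : b ^+ 2 = 1) :
  zmod_morphism (@eval_qb n q b) /\ monoid_morphism (@eval_qb n q b).
Proof.
have [qB qM] := eval_q_morphism q1.
have [phi phiE] : exists phi : {rmorphism Zq n -> int}, @eval_q n q = phi.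
  pose phi : {rmorphism Zq n -> int} := HB.pack (@eval_q n q)
    (GRing.isZmodMorphism.Build _ _ _ qB) (GRing.isMonoidMorphism.Build _ _ _ qM).
  by exists phi.
rewrite /eval_qb phiE.
have evm (p : {poly Zq n}) :
    (map_poly phi (Pdiv.CommonRing.rmodp p (mk_monic ('X^2 - 1)))).[b] = (map_poly phi p).[b].
  have mon := monic_mk_monic ('X^2 - 1 : {poly Zq n}).
  rewrite {2}(Pdiv.RingMonic.rdivp_eq mon p) rmorphD rmorphM hornerD hornerM.
  rewrite mk_monic_Xn_sub1 // rmorphB /= map_polyXn rmorph1.
  by rewrite !hornerE b1 subrr mulr0 add0r.
split; first by move=> x y; rewrite !raddfB hornerD hornerN.
by split; [rewrite /= map_polyC hornerC; exact: rmorph1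
          |move=> x y; rewrite /= evm rmorphM hornerM].
Qed.

Lemma q_odd_unity : q_odd n ^+ n = 1.
Proof.
rewrite /q_odd -rmorphXn -[1 in RHS](rmorph1 (in_qpoly ('X^n - 1))).
apply/eqP; rewrite -subr_eq0 -rmorphB; apply/eqP/val_inj => /=.
by rewrite mk_monic_Xn_sub1 // Pdiv.RingMonic.rmodpp // -polyC1 monicXnsubC.
Qed.

Lemma q_even_unity : q_even n ^+ n = 1.
Proof. by rewrite /q_even -rmorphXn q_odd_unity rmorph1. Qed.

Lemma b_even_unity : b_even n ^+ 2 = 1.
Proof.
rewrite /b_even -rmorphXn -[1 in RHS](rmorph1 (in_qpoly ('X^2 - 1))).
apply/eqP; rewrite -subr_eq0 -rmorphB; apply/eqP/val_inj => /=.
by rewrite mk_monic_Xn_sub1 // Pdiv.RingMonic.rmodpp // -polyC1 monicXnsubC.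
Qed.

Lemma eval_q_odd q : q ^+ n = 1 -> eval_q q (q_odd n) = q.
Proof.
move=> q1; rewrite /eval_q /=.
have mon := monic_mk_monic ('X^n - 1 : {poly int}).
have := congr1 (horner^~ q) (Pdiv.RingMonic.rdivp_eq mon 'X).
rewrite /= hornerD hornerM {2}mk_monic_Xn_sub1 // !hornerE q1 subrr mulr0 add0r.
by move=> <-.
Qed.

Lemma eval_qb_q_even q b : q ^+ n = 1 -> eval_qb q b (q_even n) = q.
Proof.
move=> q1; have [qB qM] := eval_q_morphism q1.
have q0 : @eval_q n q 0 = 0 by rewrite /eval_q horner0.
have -> : eval_qb q b (q_even n) = (eval_q q (q_odd n))%:P.[b].
  congr _.[b]; apply/polyP => i; rewrite coef_map_id0 //= !coefC.
  by case: eqP.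
by rewrite hornerC eval_q_odd.
Qed.

Lemma eval_qb_b_even q b : q ^+ n = 1 -> eval_qb q b (b_even n) = b.
Proof.
move=> q1; have [qB qM] := eval_q_morphism q1.
have q0 : @eval_q n q 0 = 0 by rewrite /eval_q horner0.
rewrite /eval_qb /b_even qpolyXE; first last.
- by rewrite -polyC1 monicXnsubC.
- by rewrite -polyC1 size_XnsubC.
rewrite -['X]mul1r -[1]/(1%:P) .
have -> : map_poly (@eval_q n q) (1%:P * 'X) = 'X.
  apply/polyP => i; rewrite coef_map_id0 // mul1r !coefX.
  by case: (i == 1)%N; rewrite ?qM.1 ?q0.
by rewrite hornerX.
Qed.

End Eval.

(* Main.v *)
Require Import Defs.
From HB Require Import structures.
From mathcomp Require Import all_boot all_order all_algebra.

(* The bracket is a polynomial in A, B, C, so it commutes with ring morphisms;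
   setting q = 1 and b = 1 or -1 in the value of the circle gives 3n or n. *)

Import GRing.Theory.
Local Open Scope ring_scope.

(** Both sides are brackets of the same blowup with [A = 1], [B = -1], so only the circle values
    matter. Evaluating at roots [q ^+ n = 1], [b ^+ 2 = 1] is a ring morphism, as is evaluating the
    Penrose polynomial; [rmorph_bracket] moves each inside the bracket and leaves two integer circle
    values to compare. *)

Lemma rmorph_bracket (R S : comNzRingType) (f : {rmorphism R -> S})
    (A B C : R) (G : trivalent_pm_graph) :
  f (bracket A B C G) = bracket (f A) (f B) (f C) G.
Proof.
rewrite /bracket /diagram_bracket.
move: #|dmatching _| => k.
elim: k (diagram_of G) => [|k IH] D /=; first exact: rmorphXn.
(* The edge picked depends only on the diagram, not on the ring, so both sides expand at the same
   edge. *)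
case: pickP => [m _|_]; last exact: rmorphXn.
by rewrite rmorphD !rmorphM !IH.
Qed.

Lemma horner_penrose (G : ribbon_graph) (x : int) :
  (penrose G).[x] = bracket 1 (-1) x (blowup_trivalent_pm G).
Proof.
rewrite -[LHS]/(horner_eval x (penrose G)) rmorph_bracket rmorphN1 rmorph1.
by rewrite /= /horner_eval hornerX.
Qed.

Lemma eval_q_nbracket_odd (n : nat) (G : trivalent_pm_graph) (q : int) :
  (0 < n)%N -> q ^+ n = 1 ->
  eval_q q (nbracket_odd n G) = bracket 1 (-1) (3 * \sum_(i < n) q ^+ i) G.
Proof.
move=> n_gt0 q1; have [qB qM] := eval_q_morphism n_gt0 q1.
(* Multiplicativity rests on [q ^+ n = 1], so the morphism is packed locally, under that
   hypothesis. *)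
pose f : {rmorphism Zq n -> int} := HB.pack (@eval_q n q)
  (GRing.isZmodMorphism.Build _ _ _ qB) (GRing.isMonoidMorphism.Build _ _ _ qM).
have fq : f (q_odd n) = q by exact: eval_q_odd.
rewrite -[LHS]/(f (nbracket_odd n G)) rmorph_bracket rmorphN1 rmorph1.
rewrite rmorphM rmorph_nat rmorph_sum; congr (bracket _ _ (_ * _) _).
by apply: eq_bigr => i _; rewrite rmorphXn fq.
Qed.

Lemma eval_qb_nbracket_even (n : nat) (G : trivalent_pm_graph) (q b : int) :
  (0 < n)%N -> q ^+ n = 1 -> b ^+ 2 = 1 ->
  eval_qb q b (nbracket_even n G) =
  bracket 1 (-1)
    (2 * (\sum_(i < n./2) 2 * q ^+ (2 * i)
          + \sum_(i < n./2) q ^+ (2 * i + 1) * b)) G.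
Proof.
move=> n_gt0 q1 b1; have [qbB qbM] := eval_qb_morphism n_gt0 q1 b1.
pose f : {rmorphism Zqb n -> int} := HB.pack (@eval_qb n q b)
  (GRing.isZmodMorphism.Build _ _ _ qbB) (GRing.isMonoidMorphism.Build _ _ _ qbM).
have fq : f (q_even n) = q by exact: eval_qb_q_even.
have fb : f (b_even n) = b by exact: eval_qb_b_even.
rewrite -[LHS]/(f (nbracket_even n G)) rmorph_bracket rmorphN1 rmorph1.
rewrite rmorphM rmorph_nat rmorphD !rmorph_sum.
congr (bracket _ _ (_ * (_ + _)) _); apply: eq_bigr => i _.
  by rewrite rmorphM rmorph_nat rmorphXn fq.
by rewrite rmorphM rmorphXn fq fb.
Qed.

Theorem proposition5p2p1 (G : ribbon_graph) (n : nat) (n_gt0 : (0 < n)%N) :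
  (~~ odd n ->
     eval_qb 1 1 (nbracket_even n (blowup_trivalent_pm G))
       = (penrose G).[(3 * n)%:R]
  /\ eval_qb 1 (-1) (nbracket_even n (blowup_trivalent_pm G))
       = (penrose G).[n%:R])
/\ (odd n ->
     eval_q 1 (nbracket_odd n (blowup_trivalent_pm G))
       = (penrose G).[(3 * n)%:R]).
Proof.
have q1 : 1 ^+ n = 1 :> int by rewrite expr1n.
split=> [n_even|_]; last first.
  rewrite eval_q_nbracket_odd // horner_penrose natrM.
  under eq_bigr do rewrite expr1n.
  by rewrite sumr_const card_ord.
have nE : n%:R = 2 * n./2%:R :> int by rewrite -natrM mul2n even_halfK.
(* At [q = 1] the sums give [n./2] copies of [2 + b]; the outer factor 2 turns [n./2] into [n], as
   [n] is even. Then [b = 1] yields [3 * n] and [b = -1] yields [n]. *)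
have C_eval (b : int) : b ^+ 2 = 1 ->
    eval_qb 1 b (nbracket_even n (blowup_trivalent_pm G)) =
    bracket 1 (-1) (n%:R * (2 + b)) (blowup_trivalent_pm G).
  move=> b1; rewrite eval_qb_nbracket_even //; congr bracket.
  under eq_bigr do rewrite expr1n mulr1.
  under [X in _ + X]eq_bigr do rewrite expr1n mul1r.
  by rewrite !sumr_const card_ord -mulrnDl nE mulr_natr mulrnAr -mulrnAl.
rewrite !C_eval ?sqrrN ?expr1n // !horner_penrose natrM [3 * _]mulrC.
by rewrite -[2 - 1 : int]/(1 : int) mulr1.
Qed.
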